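(* For every LTLf formula $\varphi$: if $\vdash\varphi$ then $\models\varphi$.
   Context: Fix a set $\mathrm{Var}$ of propositional variables. LTLf formulae are generated by $\varphi,\psi ::= v \mid \bot \mid \varphi\Rightarrow\psi \mid \mathsf{X}\varphi \mid \varphi\,\mathcal{W}\,\psi$ with $v\in\mathrm{Var}$. Abbreviations: $\neg\varphi := \varphi\Rightarrow\bot$; $\top:=\neg\bot$; $\varphi\vee\psi := \neg\varphi\Rightarrow\psi$; $\varphi\wedge\psi := \neg(\neg\varphi\vee\neg\psi)$; $\varphi\Leftrightarrow\psi := (\varphi\Rightarrow\psi)\wedge(\psi\Rightarrow\varphi)$; $\mathsf{end} := \neg\mathsf{X}\top$; $\bullet\varphi := \neg\mathsf{X}\neg\varphi$; $\Box\varphi := \varphi\,\mathcal{W}\,\bot$; $\Diamond\varphi := \neg\Box\neg\varphi$. Semantics: a Kripke structure is a finite nonempty sequence $K^n=(\eta_1,\dots,\eta_n)$, $n\ge 1$, of valuations $\eta_i:\mathrm{Var}\to\{\mathfrak t,\mathfrak f\}$. For $1\le i\le n$: $K^n_i(v)=\eta_i(v)$; $K^n_i(\bot)=\mathfrak f$; $K^n_i(\varphi\Rightarrow\psi)=\mathfrak t$ iff $K^n_i(\varphi)=\mathfrak f$ or $K^n_i(\psi)=\mathfrak t$; $K^n_i(\mathsf{X}\varphi)=K^n_{i+1}(\varphi)$ if $i<n$ and $\mathfrak f$ if $i=n$; $K^n_i(\varphi\,\mathcal W\,\psi)=\mathfrak t$ iff either $K^n_j(\varphi)=\mathfrak t$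 for all $i\le j\le n$, or there is $i\le k\le n$ with $K^n_k(\psi)=\mathfrak t$ and $K^n_j(\varphi)=\mathfrak t$ for all $i\le j<k$. $\models\varphi$ iff $K^n_i(\varphi)=\mathfrak t$ for every Kripke structure $K^n$ and every $1\le i\le n$. Proof system: $\vdash\varphi$ means $\varphi$ is derivable in the system closed under propositional reasoning (all instances of propositional tautologies; modus ponens) together with: (WkNextDistr) $\vdash\bullet(\varphi\Rightarrow\psi)\Leftrightarrow(\bullet\varphi\Rightarrow\bullet\psi)$; (EndNextContra) $\vdash\mathsf{end}\Rightarrow\neg\mathsf{X}\varphi$; (Finite) $\vdash\Diamond\mathsf{end}$; (WkUntilUnroll) $\vdash\varphi\,\mathcal W\,\psi\Leftrightarrow\psi\vee(\varphi\wedge\bullet(\varphi\,\mathcal W\,\psi))$; (WkNextStep) from $\vdash\varphi$ infer $\vdash\bullet\varphi$; (Induction) from $\vdash\varphi\Rightarrow\psi$ and $\vdash\varphi\Rightarrow\bullet\varphi$ infer $\vdash\varphi\Rightarrow\Box\psi$. *)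

(* Defs.v *)
From mathcomp Require Import all_boot.

Set Implicit Arguments.
Unset Strict Implicit.
Unset Printing Implicit Defensive.

Inductive formula (Var : Type) : Type :=
| FVar of Var
| FBot
| FImp of formula Var & formula Var
| FNext of formula Var
| FWUntil of formula Var & formula Var.

Arguments FBot {Var}.

Definition FNot (Var : Type) (p : formula Var) : formula Var :=
  FImp p FBot.
Definition FTop (Var : Type) : formula Var := FNot FBot.
Arguments FTop {Var}.

Definition FOr (Var : Type) (p q : formula Var) : formula Var :=
  FImp (FNot p) q.
Definition FAnd (Var : Type) (p q : formula Var) : formula Var :=
  FNot (FOr (FNot p) (FNot q)).
Definition FIff (Var : Type) (p q : formula Var) : formula Var :=
  FAnd (FImp p q) (FImp q p).
Definition FEnd (Var : Type) : formula Var := FNot (FNext FTop).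
Arguments FEnd {Var}.

Definition FWNext (Var : Type) (p : formula Var) : formula Var :=
  FNot (FNext (FNot p)).
Definition FBox (Var : Type) (p : formula Var) : formula Var :=
  FWUntil p FBot.
Definition FDia (Var : Type) (p : formula Var) : formula Var :=
  FNot (FBox (FNot p)).

(* Positions are numbered from 0: [K i] is the valuation $\eta_{i+1}$. *)
Definition kripke (Var : Type) (n : nat) := 'I_n -> Var -> bool.

Fixpoint eval (Var : Type) (n : nat) (K : kripke Var n) (p : formula Var)
    (i : 'I_n) : bool :=
  match p with
  | FVar v => K i v
  | FBot => false
  | FImp p1 p2 => ~~ eval K p1 i || eval K p2 i
  (* [insub i.+1] is [None] exactly when [i] is the last position. *)
  | FNext p1 => if insub i.+1 is Some j then eval K p1 j else false
  | FWUntil p1 p2 =>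
      [forall j : 'I_n, (i <= j) ==> eval K p1 j]
      || [exists k : 'I_n, [&& i <= k, eval K p2 k &
            [forall j : 'I_n, (i <= j < k) ==> eval K p1 j]]]
  end.

Definition valid (Var : Type) (p : formula Var) : Prop :=
  forall n : nat, 0 < n -> forall (K : kripke Var n) (i : 'I_n), eval K p i.

Inductive prop_formula : Type :=
| PVar of nat
| PBot
| PImp of prop_formula & prop_formula.

Fixpoint prop_eval (a : nat -> bool) (t : prop_formula) : bool :=
  match t with
  | PVar x => a x
  | PBot => false
  | PImp t1 t2 => ~~ prop_eval a t1 || prop_eval a t2
  end.

Definition tautology (t : prop_formula) : Prop :=
  forall a : nat -> bool, prop_eval a t.

Fixpoint prop_subst (Var : Type) (s : nat -> formula Var) (t : prop_formula) :
    formula Var :=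
  match t with
  | PVar x => s x
  | PBot => FBot
  | PImp t1 t2 => FImp (prop_subst s t1) (prop_subst s t2)
  end.

Inductive derivable (Var : Type) : formula Var -> Prop :=
| Taut (t : prop_formula) (s : nat -> formula Var) :
    tautology t -> derivable (prop_subst s t)
| ModusPonens p q : derivable p -> derivable (FImp p q) -> derivable q
| WkNextDistr p q :
    derivable (FIff (FWNext (FImp p q)) (FImp (FWNext p) (FWNext q)))
| EndNextContra p : derivable (FImp FEnd (FNot (FNext p)))
| Finite : derivable (FDia FEnd)
| WkUntilUnroll p q :
    derivable (FIff (FWUntil p q) (FOr q (FAnd p (FWNext (FWUntil p q)))))
| WkNextStep p : derivable p -> derivable (FWNext p)
| Induction p q :
    derivable (FImp p q) -> derivable (FImp p (FWNext p)) ->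
    derivable (FImp p (FBox q)).

(* Main.v *)
Require Import Defs.
From mathcomp Require Import all_boot.

(** Soundness is an induction on the derivation: over a fixed Kripke structure, every axiom is true
    at all positions and every rule preserves truth at all positions. The quantification over
    positions stays inside the induction, since the rules for weak next and box use their premises
    at later positions. Three temporal facts carry the argument: a weak until is determined by the
    current position and the successor ([eval_wuntil_unroll]); the last position, which lies ahead
    of every other, satisfies [FEnd] ([eval_dia_end]); a formula preserved by each step propagates
    forward ([eval_invariant]). *)

Section Semantics.
Variables (Var : Type) (n : nat) (K : kripke Var n).
Implicit Types (p q : formula Var) (i j : 'I_n).

Lemma eval_imp p q i : eval K (FImp p q) i = (eval K p i ==> eval K q i).
Proof. by rewrite implybE. Qed.

Lemma eval_and p q i : eval K (FAnd p q) i = eval K p i && eval K q i.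
Proof. by rewrite /=; case: (eval K p i); case: (eval K q i). Qed.

Lemma eval_or p q i : eval K (FOr p q) i = eval K p i || eval K q i.
Proof. by rewrite /=; case: (eval K p i); case: (eval K q i). Qed.

Lemma eval_iff p q i : eval K (FIff p q) i = (eval K p i == eval K q i).
Proof. by rewrite eval_and /=; case: (eval K p i); case: (eval K q i). Qed.

(** The outer negation flips the default of [FNext], hence the value [true] when there is no
    successor. *)
Lemma eval_wnext p i :
  eval K (FWNext p) i = if insub i.+1 is Some j then eval K p j else true.
Proof. by rewrite /=; case: insub => [j|] //=; rewrite !orbF negbK. Qed.

Lemma eval_box p i : eval K (FBox p) i = [forall j : 'I_n, (i <= j) ==> eval K p j].
Proof.
rewrite /= -[RHS]orbF; congr (_ || _).
by apply/negbTE/existsPn => k; rewrite andbF.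
Qed.

Lemma eval_dia p i : eval K (FDia p) i = [exists j : 'I_n, (i <= j) && eval K p j].
Proof.
have -> : eval K (FDia p) i = ~~ eval K (FBox (FNot p)) i by rewrite /= orbF.
rewrite eval_box negb_forall; apply: eq_existsb => j.
by rewrite negb_imply /= orbF negbK.
Qed.

Lemma eval_wuntilP p q i :
  reflect ((forall j : 'I_n, i <= j -> eval K p j) \/
           exists k : 'I_n, [/\ i <= k, eval K q k &
                         forall j : 'I_n, i <= j -> j < k -> eval K p j])
          (eval K (FWUntil p q) i).
Proof.
apply: (iffP orP) => [] [H|H]; [left|right|left|right].
- by move=> j ij; move/forallP/(_ j)/implyP: H; apply.
- case/existsP: H => k /and3P[ik qk /forallP H]; exists k; split=> // j ij jk.
  by move/implyP: (H j); apply; rewrite ij.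
- by apply/forallP => j; apply/implyP; apply: H.
- case: H => k [ik qk H]; apply/existsP; exists k; apply/and3P; split=> //.
  by apply/forallP => j; apply/implyP => /andP[]; apply: H.
Qed.

(** The positions from [i] on are [i] itself and those from [i.+1] on; both disjuncts of the until
    split along this division. *)
Lemma eval_wuntil_unroll p q i :
  eval K (FWUntil p q) i =
  eval K q i || eval K p i && eval K (FWNext (FWUntil p q)) i.
Proof.
rewrite eval_wnext; apply/eval_wuntilP/idP => [[H|[k [ik qk H]]]|].
- rewrite (H i) //=; case: insubP => [j _ ij|_]; last by rewrite orbT.
  apply/orP; right; apply/eval_wuntilP; left=> l jl; apply: H.
  by apply: ltnW; rewrite -ij.
- move: ik; rewrite leq_eqVlt => /orP[/eqP/val_inj ->|ik]; first by rewrite qk.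
  rewrite (H i) //=; apply/orP; right; case: insubP => // j _ ij.
  apply/eval_wuntilP; right; exists k; rewrite ij; split=> // l il.
  by apply: H; apply: ltnW.
- case/orP => [qi|/andP[pi]].
    (* The witness is [i] itself: no [j] satisfies [i <= j < i]. *)
    right; exists i; split=> // j ij ji.
    by move: (leq_ltn_trans ij ji); rewrite ltnn.
  have split_le (j : 'I_n) (P : Prop) : (i < j -> P) -> (j = i -> P) -> i <= j -> P.
    by move=> Plt Peq; rewrite leq_eqVlt => /orP[/eqP/val_inj/esym|].
  case: insubP => [j _ ij /eval_wuntilP|].
    rewrite ij => -[H|[k [ik qk H]]]; [left|right].
      by move=> l; apply: split_le => [|->//]; apply: H.
    exists k; split=> //; first exact: ltnW.
    by move=> l; apply: split_le => [|->//]; apply: H.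
  (* Here [i] is the last position, so [p] only has to hold at [i]. *)
  rewrite -leqNgt => last_i _; left=> j; apply: split_le => [|->//].
  by rewrite ltnNge -ltnS (leq_trans (ltn_ord j) last_i).
Qed.

Lemma eval_end_last i : n <= i.+1 -> eval K FEnd i.
Proof. by move=> ni /=; rewrite insubN // -leqNgt. Qed.

Lemma eval_dia_end i : eval K (FDia FEnd) i.
Proof.
have n_gt0 : 0 < n by apply: leq_ltn_trans (ltn_ord i).
have last_lt : n.-1 < n by rewrite prednK.
rewrite eval_dia; apply/existsP; exists (Ordinal last_lt).
by rewrite eval_end_last /= ?prednK // -ltnS prednK // ltn_ord.
Qed.

(** Induction on the distance [j - i]; every intermediate position has a successor, so weak next
    really moves one step ahead. *)
Lemma eval_invariant p :
  (forall i, eval K (FImp p (FWNext p)) i) ->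
  forall i j : 'I_n, i <= j -> eval K p i -> eval K p j.
Proof.
move=> step i j /subnKC; move: (j - i) => d; elim: d j => [|d IHd] j.
  by rewrite addn0 => /val_inj ->.
rewrite addnS => ij pi; have lt_n : i + d < n by apply: ltnW; rewrite ij.
have := step (Ordinal lt_n); rewrite eval_imp.
move=> /implyP/(_ (IHd (Ordinal lt_n) erefl pi)).
by rewrite eval_wnext /= ij valK.
Qed.

Lemma eval_prop_subst (s : nat -> formula Var) t i :
  eval K (prop_subst s t) i = prop_eval (fun x => eval K (s x) i) t.
Proof. by elim: t => //= t1 -> t2 ->. Qed.

End Semantics.

Theorem theorem4p2 (Var : Type) (phi : formula Var) :
  derivable phi -> valid phi.
Proof.
move=> der n _ K; elim: phi / der.
- by move=> t s taut i; rewrite eval_prop_subst.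
- by move=> p q _ Hp _ Hpq i; have := Hpq i; rewrite eval_imp Hp.
(* At the last position all three weak nexts are true; elsewhere the claim is about the successor
   alone. *)
- move=> p q i; rewrite eval_iff eval_imp !eval_wnext; case: insub => // j.
  by rewrite eval_imp.
(* A successor refutes [FEnd]; without one, [FNext p] is false. *)
- by move=> p i /=; case: insub.
- exact: eval_dia_end.
- by move=> p q i; rewrite eval_iff eval_or eval_and eval_wuntil_unroll.
- by move=> p _ Hp i; rewrite eval_wnext; case: insub.
- move=> p q _ Hpq _ step i.
  rewrite eval_imp eval_box; apply/implyP => pi.
  apply/forallP => j; apply/implyP => ij.
  by have := Hpq j; rewrite eval_imp (eval_invariant _ _ _ _ step _ _ ij pi).
Qed.
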